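(* For every finite simple graph $G$ with at least one vertex, $$\frac{|V(G)|}{2\alpha(G)}+\frac12\;\le\;\frac{\mathring{s}(G)}{|V(G)|}\;\le\;\max\left\{\frac{|V(H)|}{\alpha(H)} : H\subseteq G\right\},$$ where the maximum is over all subgraphs $H$ of $G$ with at least one vertex. These bounds are sharp. Equality holds in the upper bound if and only if $G$ has no edges. Moreover, if $G$ is a complete multipartite graph that is regular, then equality holds in the lower bound if and only if $\chi(G)=1$ or $\alpha(G)\le 2$.
   Context: All graphs are finite and simple. The slow-coloring game on a graph $G$ is played by Lister and Painter. On each round, Lister marks a nonempty subset $M$ of the uncolored vertices, scoring $|M|$ points; Painter then colors (with a new color) a subset of $M$ that is independent in $G$. The game ends when all vertices are colored. Painter wants to minimize the total score and Lister wants to maximize it. The sum-color cost $\mathring{s}(G)$ is the total score under optimal play by both players (the score that each player can guarantee doing no worse than). $\alpha(G)$ is the maximum size of an independent set in $G$, and $\chi(G)$ is the chromatic number. Equality in the lower bound means $\frac{|V(G)|}{2\alpha(G)}+\frac12=\frac{\mathring{s}(G)}{|V(G)|}$, and similarly for the upper bound. A complete multipartite graph is a graph whose vertex set is partitioned into nonempty parts such that two vertices are adjacent if and only if they lie in different parts (a single part is allowed). *)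

(* Defs.v *)
From HB Require Import structures.
From mathcomp Require Import all_boot all_order all_algebra.

Set Implicit Arguments.
Unset Strict Implicit.
Unset Printing Implicit Defensive.

(* A graph is a pair (vertex set, edge set) inside an ambient finite type T,  *)
(* so that a graph and its subgraphs are objects of the same type. Edges are  *)
(* two-element subsets of the vertex set.                                     *)
Definition simple_graph (T : finType) (VE : {set T} * {set {set T}}) : bool :=
  [forall e in VE.2, (#|e| == 2) && (e \subset VE.1)].

Record graph (T : finType) : predArgType := Graph {
  gval : {set T} * {set {set T}};
  gvalP : simple_graph gval
}.

HB.instance Definition _ (T : finType) := [isSub for @gval T].
HB.instance Definition _ (T : finType) := [Finite of graph T by <:].

Section Graphs.
Variable T : finType.
Implicit Types (G H : graph T) (A M I U : {set T}).

Definition vertices G : {set T} := (gval G).1.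
Definition edges G : {set {set T}} := (gval G).2.

Definition adj G : rel T := fun x y => [set x; y] \in edges G.

Lemma adj_irr G x : adj G x x = false.
Proof.
apply/negP => /(forall_inP (gvalP G)) /andP[/eqP].
by rewrite setUid cards1.
Qed.

Definition subgraph H G : bool :=
  (vertices H \subset vertices G) && (edges H \subset edges G).

Definition independent G A : bool :=
  (A \subset vertices G) && [forall x in A, forall y in A, ~~ adj G x y].

Definition alpha G : nat := \max_(A | independent G A) #|A|.

Definition colorable G (k : nat) : bool :=
  [exists f : {ffun {x : T | x \in vertices G} -> 'I_k},
     forall x, forall y, adj G (val x) (val y) ==> (f x != f y)].

Lemma colorable_ex G : exists k, colorable G k.
Proof.
exists #|{: {x : T | x \in vertices G}}|.
apply/existsP; exists [ffun x => enum_rank x].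
apply/forallP => x; apply/forallP => y; apply/implyP => xy.
rewrite !ffunE; apply: contraTneq xy => /enum_rank_inj ->.
by rewrite adj_irr.
Qed.

Definition chromatic_number G : nat := ex_minn (colorable_ex G).

Definition degree G (x : T) : nat := #|[set y | adj G x y]|.

Definition regular G : Prop :=
  exists d, forall x, x \in vertices G -> degree G x = d.

(* [partition] requires the parts to be nonempty. *)
Definition complete_multipartite G : Prop :=
  exists2 P : {set {set T}}, partition P (vertices G) &
    {in vertices G &, forall x y, adj G x y = (pblock P x != pblock P y)}.

(* The slow-coloring game. A position is the set U of uncolored vertices.     *)
Definition lister_move U M : bool := (M != set0) && (M \subset U).

(* I may be empty: Painter is allowed to color nothing. *)
Definition painter_move G M I : bool := (I \subset M) && independent G I.

(* Painter has a strategy from U by which the game ends and the total of the  *)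
(* points scored from U on is at most k. For M nonempty, k - #|M|.-1 is       *)
(* k.+1 - #|M|; it is written in this form for the guard condition.           *)
Fixpoint painter_guarantees G (k : nat) U : bool :=
  (U == set0) ||
  (if k is k'.+1 then
     [forall M, lister_move U M ==>
       [exists I, [&& painter_move G M I, #|M| <= k &
                   painter_guarantees G (k' - #|M|.-1) (U :\: I)]]]
   else false).

(* Lister has a strategy from U that scores at least k points.                *)
Fixpoint lister_guarantees G (k : nat) U : bool :=
  if k is k'.+1 then
    [exists M, lister_move U M &&
      [forall I, painter_move G M I ==>
                 lister_guarantees G (k' - #|M|.-1) (U :\: I)]]
  else true.

Lemma painter_lister G k U :
  painter_guarantees G k U = ~~ lister_guarantees G k.+1 U.
Proof.
elim/ltn_ind: k U => k IH U.
have [->|U0] := eqVneq U set0.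
  rewrite (_ : painter_guarantees G k set0); last by case: k {IH} => [|k] /=; rewrite eqxx.
  apply/esym/existsPn => M; apply/nandP; left.
  by rewrite /lister_move subset0 andNb.
case: k IH => [|k] IH.
  rewrite [LHS]/= (negbTE U0); apply/esym/negbTE; rewrite negbK.
  apply/existsP; exists U; rewrite /lister_move U0 subxx /=.
  by apply/forallP => I; apply/implyP.
rewrite [LHS]/= (negbTE U0) orFb [lister_guarantees _ _ _]/= negb_exists.
apply: eq_forallb => M; rewrite negb_and -implybE.
case: (boolP (lister_move U M)) => //= /andP[M0 _].
rewrite negb_forall; apply: eq_existsb => I; rewrite negb_imply.
case: (painter_move G M I) => //=.
move: M0; rewrite -card_gt0; case: #|M| => // m _ /=.
case: (leqP m.+1 k.+1) => [mk|km].
  by rewrite subSn // -IH // ltnS leq_subr.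
by have /eqP -> : k.+1 - m == 0 by rewrite subn_eq0.
Qed.

Lemma lister_guarantees_le G k l U :
  k <= l -> lister_guarantees G l U -> lister_guarantees G k U.
Proof.
elim/ltn_ind: l k U => -[|l] IH [|k] U //; rewrite ltnS => kl /=.
case/existsP => M /andP[UM /forallP h].
apply/existsP; exists M; rewrite UM; apply/forallP => I; apply/implyP => MI.
have /implyP/(_ MI) := h I; apply: IH; first by rewrite ltnS leq_subr.
exact: leq_sub2r.
Qed.

Lemma painter_guarantees_le G k l U :
  k <= l -> painter_guarantees G k U -> painter_guarantees G l U.
Proof. by rewrite !painter_lister => kl; apply/contra/lister_guarantees_le. Qed.

Lemma painter_guarantees_ex G : exists k, painter_guarantees G k (vertices G).
Proof.
suff h n U : U \subset vertices G -> #|U| = n -> painter_guarantees G (n * n) U.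
  by exists (#|vertices G| * #|vertices G|); apply: h.
elim: n U => [|n IH] U UG Un; first by rewrite /= -cards_eq0 Un.
rewrite mulSn addSn /=; apply/orP; right; apply/forallP => M.
apply/implyP => /andP[/set0Pn[x xM] MU]; apply/existsP; exists [set x].
have xU := subsetP MU _ xM.
have Mn : #|M| <= n.+1 by rewrite -Un subset_leq_card.
apply/and3P; split.
- rewrite /painter_move /independent !sub1set xM (subsetP UG) //=.
  apply/forall_inP => y /set1P ->; apply/forall_inP => z /set1P ->.
  by rewrite adj_irr.
- by apply: leq_trans Mn _; rewrite -addSn leq_addr.
apply: (@painter_guarantees_le _ (n * n)); last first.
  apply: IH; first by apply: subset_trans UG; apply: subsetDl.
  by apply/eqP; rewrite -eqSS -Un (cardsD1 x U) xU.
rewrite mulnS addnA leq_subRL; last by rewrite -ltnS prednK ?card_gt0;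
  [apply: leq_trans Mn _; rewrite ltnS -addnA leq_addr | apply/set0Pn; exists x].
rewrite leq_add2r; apply: leq_trans (leq_addr _ _).
by rewrite -ltnS; apply: leq_trans Mn; rewrite prednK // card_gt0; apply/set0Pn; exists x.
Qed.

Definition sum_color_cost G : nat := ex_minn (painter_guarantees_ex G).

(* The sum-color cost is the value of the game: the one score that each       *)
(* player can guarantee doing no worse than.                                  *)
Lemma sum_color_costP G s :
  painter_guarantees G s (vertices G) && lister_guarantees G s (vertices G) =
  (s == sum_color_cost G).
Proof.
rewrite /sum_color_cost; case: ex_minnP => m Pm min_m.
apply/andP/eqP => [[Ps Ls]|->].
  apply/eqP; rewrite eqn_leq min_m // andbT leqNgt; apply/negP => ms.
  by move: Pm; rewrite painter_lister (lister_guarantees_le ms Ls).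
split=> //; case: m Pm min_m => // m _ min_m.
by rewrite -[X in is_true X]negbK -painter_lister; apply/negP => /min_m; rewrite ltnn.
Qed.

Local Open Scope ring_scope.

Definition average_cost G : rat :=
  (sum_color_cost G)%:R / #|vertices G|%:R.

Definition lower_bound G : rat :=
  #|vertices G|%:R / (2%:R * (alpha G)%:R) + 1 / 2%:R.

(* The default 0 plays no role when G has a vertex: G itself is then in the   *)
(* range and every term is positive.                                          *)
Definition upper_bound G : rat :=
  \big[Num.max/0]_(H : graph T | subgraph H G && (vertices H != set0))
     (#|vertices H|%:R / (alpha H)%:R).

End Graphs.

(* Main.v *)
Require Import Defs.
From mathcomp Require Import all_boot all_order all_algebra.
From mathcomp Require Import zify ring lra.
Import Order.TTheory GRing.Theory Num.Theory.

Set Implicit Arguments.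
Unset Strict Implicit.
Unset Printing Implicit Defensive.

(** Write n for the number of vertices, a for the independence number, s for
    the sum-color cost and rho for the largest ratio #|H| / alpha H.

    Lower bound.  Lister marks every uncolored vertex in each round.  With u
    vertices uncolored, Painter colors i <= a of them, and
    f(u) = u^2 / (2a) + u / 2 satisfies f(u) - f(u - i) <= u, where for u > 0
    equality holds only if i = a ([painter_guarantees_lower]).

    Upper bound.  Painter colors a largest independent subset I of the marked
    set M, so that #|M| <= rho * #|I|, and the scores add up to at most
    rho * n.  In the last round M = I, which saves rho - 1 on this estimate:
    s <= rho * n - (rho - 1) ([lister_guarantees_upper]).  Equality with
    rho * n thus forces rho = 1, that is, no edges; without edges all three
    quantities are 1, which also gives the sharpness.

    Equality in the lower bound, for complete multipartite graphs with parts of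
    equal size a.  Such a graph enters only through the facts that nonadjacency
    is transitive and that all its classes have a elements.

    If a <= 2, let d be the number of uncolored vertices adjacent to all other
    uncolored ones, that is, the parts with a single uncolored vertex.  The
    potential u (u + 2) + d^2 bounds four times what Lister can still score
    ([lister_guarantees_alpha2]), and at the start it equals 4 f(n).

    If a >= 3 and there are at least two parts, Lister gains an extra point.
    On two completely joined sets A and B with #|B| <= #|A|, Lister scores
    #|A| + 2 #|B| by repeatedly marking one vertex on each side, and one point
    more when B is nonempty and #|A| >= 3 ([lister_guarantees_join_lt]).  Lister
    first marks everything: Painter either colors a whole part or ends up above
    f(n).  Once at most 2a vertices remain, the extra point of the join makes
    the inequality strict ([painter_guarantees_multipartite]). *)

(** * Graphs *)

Section Graph.
Variable T : finType.
Implicit Types (G H : graph T) (A B X Y M I U : {set T}).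

Lemma adj_sym G : symmetric (adj G).
Proof. by move=> x y; rewrite /adj setUC. Qed.

Lemma adj_vertices G x y : adj G x y -> (x \in vertices G) && (y \in vertices G).
Proof.
by move=> /(forall_inP (gvalP G)) /andP[_]; rewrite subUset !sub1set.
Qed.

Lemma independentP G A :
  reflect (A \subset vertices G /\ {in A &, forall x y, ~~ adj G x y})
          (independent G A).
Proof.
apply: (iffP andP) => -[AV h]; split=> //.
  by move=> x y xA yA; have /forall_inP/(_ _ yA) := forall_inP h _ xA.
by apply/forall_inP => x xA; apply/forall_inP => y; apply: h.
Qed.

Lemma independent0 G : independent G set0.
Proof. by apply/independentP; split=> [|x]; rewrite ?sub0set ?inE. Qed.

Lemma independent1 G x : x \in vertices G -> independent G [set x].
Proof.
move=> xV; apply/independentP; split=> [|y z /set1P-> /set1P->].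
  by rewrite sub1set.
by rewrite adj_irr.
Qed.

Lemma card_independent G A : independent G A -> #|A| <= alpha G.
Proof. exact: leq_bigmax_cond. Qed.

Lemma alpha_witness G : exists2 A, independent G A & #|A| = alpha G.
Proof.
case: (@eq_bigmax_cond _ (independent G) (fun A => #|A|)) => [|A iA eA].
  by apply/card_gt0P; exists set0; apply: independent0.
by exists A.
Qed.

Lemma alpha_gt0 G : vertices G != set0 -> 0 < alpha G.
Proof.
case/set0Pn=> x /independent1/card_independent; by rewrite cards1.
Qed.

Lemma alpha_le_card G : alpha G <= #|vertices G|.
Proof.
have [A /independentP[AV _] <-] := alpha_witness G; exact: subset_leq_card.
Qed.

(** A largest independent set of full size is the whole vertex set. *)
Lemma alpha_edgeless G : (alpha G == #|vertices G|) = (edges G == set0).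
Proof.
apply/eqP/eqP => [aV|e0].
  have [A /independentP[AV iA] cA] := alpha_witness G.
  have {}AV : A = vertices G by apply/eqP; rewrite eqEcard AV cA aV leqnn.
  apply/eqP/set0Pn => -[e eE].
  have /andP[/cards2P[x [y [_ exy]]] _] := forall_inP (gvalP G) _ eE.
  have axy : adj G x y by rewrite /adj -exy.
  have /andP[xV yV] := adj_vertices axy.
  by move: (iA x y); rewrite AV axy => /(_ xV yV).
apply/eqP; rewrite eqn_leq; apply/andP; split.
  exact: alpha_le_card.
apply/card_independent/independentP; split=> // x y _ _.
by rewrite /adj e0 inE.
Qed.

Lemma edgeless_subgraph G H :
  edges G = set0 -> subgraph H G -> edges H = set0.
Proof.
by move=> e0 /andP[_]; rewrite e0 subset0 => /eqP.
Qed.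

Lemma induced_simple G M :
  simple_graph (vertices G :&: M, [set e in edges G | e \subset M]).
Proof.
apply/forall_inP => e /=; rewrite inE => /andP[eG eM].
by have /andP[-> eV] := forall_inP (gvalP G) _ eG; rewrite subsetI eV.
Qed.

Definition induced G M : graph T := Graph (induced_simple G M).

Lemma induced_subgraph G M : subgraph (induced G M) G.
Proof.
by apply/andP; split; [apply: subsetIl | apply/subsetP => e; rewrite inE => /andP[]].
Qed.

Lemma independent_induced G M I :
  independent (induced G M) I -> painter_move G M I.
Proof.
case/independentP=> /subsetIP[IV IM] iI; rewrite /painter_move IM /=.
apply/independentP; split=> // x y xI yI.
apply: contra (iI x y xI yI) => xy; rewrite /adj inE.
by rewrite -/(adj G x y) xy subUset !sub1set !(subsetP IM).
Qed.

(** * Rounds of the game *)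

Lemma lister_guarantees_mark G k U M :
  lister_move U M ->
  (forall I, painter_move G M I -> lister_guarantees G k (U :\: I)) ->
  lister_guarantees G (#|M| + k) U.
Proof.
move=> UM h; have /andP[M0 _] := UM; rewrite -card_gt0 in M0.
rewrite -(prednK M0) addSn /=; apply/existsP; exists M; rewrite UM /=.
by apply/forallP => I; apply/implyP => /h; rewrite addKn.
Qed.

Lemma lister_guarantees_markI G k U :
  0 < k -> lister_guarantees G k U ->
  exists2 M, lister_move U M &
    forall I, painter_move G M I -> lister_guarantees G (k - #|M|) (U :\: I).
Proof.
case: k => // k _ /existsP[M /andP[UM /forallP h]]; exists M => // I MI.
have /andP[M0 _] := UM; rewrite -card_gt0 in M0.
by have := implyP (h I) MI; rewrite -{2}(prednK M0) subSS.
Qed.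

Lemma lister_guarantees0 G k : lister_guarantees G k set0 -> k = 0.
Proof.
by case: k => // k /existsP[M /andP[/andP[M0]]]; rewrite subset0 (negbTE M0).
Qed.

Lemma painter_guarantees_colorI G k U M :
  painter_guarantees G k U -> lister_move U M ->
  exists I, [/\ painter_move G M I, #|M| <= k &
                painter_guarantees G (k - #|M|) (U :\: I)].
Proof.
move=> PU UM; have /andP[M0 MU] := UM.
have U0 : U == set0 = false.
  by apply: contraNF M0 => /eqP U0; rewrite U0 subset0 in MU.
rewrite -card_gt0 in M0.
case: k PU => [|k] /=; rewrite U0 //= => /forallP/(_ M)/implyP/(_ UM).
case/existsP=> I /and3P[MI Mk PI]; exists I; split=> //.
by rewrite -(prednK M0) subSS.
Qed.

(** Lister can ignore the extra uncolored vertices. *)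
Lemma lister_guarantees_sub G k U U' :
  U \subset U' -> lister_guarantees G k U -> lister_guarantees G k U'.
Proof.
elim/ltn_ind: k U U' => -[|k] IH U U' UU' // /(lister_guarantees_markI (ltn0Sn k)).
case=> M UM h; have /andP[M0 MU] := UM; rewrite -card_gt0 in M0.
apply: (@lister_guarantees_le _ _ _ (#|M| + (k.+1 - #|M|))); first by lia.
apply: lister_guarantees_mark => [|I /h].
  by rewrite /lister_move -card_gt0 M0 (subset_trans MU).
by apply: IH; [lia | apply: setSD].
Qed.

Lemma painter_guarantees_cost G : painter_guarantees G (sum_color_cost G) (vertices G).
Proof. by have := sum_color_costP G (sum_color_cost G); rewrite eqxx => /andP[]. Qed.

Lemma lister_guarantees_cost G : lister_guarantees G (sum_color_cost G) (vertices G).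
Proof. by have := sum_color_costP G (sum_color_cost G); rewrite eqxx => /andP[]. Qed.

Lemma card_setD_sub U I : I \subset U -> #|U :\: I| + #|I| = #|U|.
Proof. by move=> IU; rewrite -(cardsID I U) (setIidPr IU) addnC. Qed.

(** * The lower bound *)

(** Lister marks everything: if Painter colors i <= alpha of u vertices, then
    u^2 + alpha u drops by i (2u - i + alpha), which is at most 2 alpha u since
    (alpha - i) (2u - i) >= 0. *)
Lemma painter_guarantees_lower G k U :
  painter_guarantees G k U ->
  #|U| ^ 2 + alpha G * #|U| <= 2 * alpha G * k.
Proof.
elim/ltn_ind: k U => k IH U PU.
have [->|U0] := eqVneq U set0; first by rewrite cards0 muln0.
have [|I [/andP[IU iI] Uk PI]] := painter_guarantees_colorI (M := U) PU.
  by rewrite /lister_move U0 subxx.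
have := IH _ _ _ PI; have := card_independent iI.
have := card_setD_sub IU; rewrite -card_gt0 in U0.
move: #|U :\: I| #|I| #|U| Uk U0 (alpha G) => v i u uk u0 a eu ia.
have ek : k = u + (k - u) by lia.
move: (k - u) ek => l -> /(_ ltac:(lia)); nia.
Qed.

(** * The upper bound *)

(** Bounding what Lister can guarantee, rather than showing that Painter
    guarantees every natural number above the bound, avoids rounding a
    rational.  The term rho - 1 is what Painter saves in the last round, where
    the colored set is the whole marked set. *)
Lemma lister_guarantees_upper G (rho : rat) k U :
  (1 <= rho)%R ->
  (forall M, M != set0 -> M \subset vertices G ->
     exists2 I, painter_move G M I & (#|M|%:R <= rho * #|I|%:R)%R) ->
  U \subset vertices G -> U != set0 -> lister_guarantees G k U ->
  (k%:R <= rho * #|U|%:R - (rho - 1))%R.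
Proof.
move=> rho1 rhoP; elim/ltn_ind: k U => k IH U UV U0 LU.
have U1 : (1 <= #|U|%:R :> rat)%R by rewrite ler1n card_gt0.
have [->|k0] := posnP k; first by nra.
have [M /andP[M0 MU] h] := lister_guarantees_markI k0 LU.
have [I MI Mrho] := rhoP M M0 (subset_trans MU UV).
have /andP[IM iI] := MI; have LI := h I MI.
have cU := card_setD_sub (subset_trans IM MU).
have kM : (k%:R <= #|M|%:R + (k - #|M|)%:R :> rat)%R.
  by rewrite -natrD ler_nat; lia.
have [e|n0] := eqVneq (U :\: I) set0.
  (* The last round: nothing can be scored afterwards. *)
  have UM : #|U| = #|M|.
    apply/eqP; rewrite eqn_leq (subset_leq_card MU) andbT subset_leq_card //.
    by apply: subset_trans IM; rewrite -setD_eq0 e.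
  rewrite e in LI; rewrite (lister_guarantees0 LI) -UM in kM; nra.
rewrite -card_gt0 in M0.
have := IH _ _ _ (subset_trans (subsetDl _ _) UV) n0 LI.
rewrite -cU natrD => /(_ ltac:(lia)); nra.
Qed.

(** * Joins *)

(** An independent set meets at most one of two joined sets.  By monotonicity
    Painter may be assumed to color all marked vertices on one of the sides. *)
Lemma lister_guarantees_join G A B X Y k :
  {in A & B, forall x y, adj G x y} ->
  X \subset A -> Y \subset B -> X != set0 ->
  lister_guarantees G k ((A :\: X) :|: B) ->
  lister_guarantees G k (A :|: (B :\: Y)) ->
  lister_guarantees G (#|X| + #|Y| + k) (A :|: B).
Proof.
move=> AB XA YB X0 LX LY.
have dXY : X :&: Y = set0.
  apply/setP => x; rewrite !inE; apply/negP => /andP[xX xY].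
  by have := AB x x (subsetP XA _ xX) (subsetP YB _ xY); rewrite adj_irr.
have -> : #|X| + #|Y| = #|X :|: Y| by rewrite cardsU dXY cards0 subn0.
apply: lister_guarantees_mark => [|I /andP[IXY /independentP[_ iI]]].
  rewrite /lister_move setUSS // andbT -card_gt0.
  by apply: leq_trans (subset_leq_card (subsetUl X Y)); rewrite card_gt0.
have AI x : x \in A -> x \in I -> x \in X.
  move=> xA xI; have /setUP[//|xY] := subsetP IXY x xI.
  by have := AB x x xA (subsetP YB _ xY); rewrite adj_irr.
have BI x : x \in B -> x \in I -> x \in Y.
  move=> xB xI; have /setUP[xX|//] := subsetP IXY x xI.
  by have := AB x x (subsetP XA _ xX) xB; rewrite adj_irr.
have [/pred0P IA|/pred0Pn[a /andP[/= aI aA]]] := boolP [disjoint I & A].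
  apply: lister_guarantees_sub LY; apply/subsetP => x; rewrite !inE.
  case/orP=> [xA|/andP[xY xB]].
    by have := IA x; rewrite /= xA andbT => ->.
  by rewrite xB orbT andbT; apply: contra xY; apply: BI.
apply: lister_guarantees_sub LX; apply/subsetP => x; rewrite !inE.
case/orP=> [/andP[xX xA]|xB].
  by rewrite xA andbT; apply: contra xX; apply: AI.
rewrite xB orbT andbT; apply/negP => xI.
by have := iI a x aI xI; rewrite AB.
Qed.

Lemma lister_guarantees_join1 G A B a b k :
  {in A & B, forall x y, adj G x y} -> a \in A -> b \in B ->
  lister_guarantees G k ((A :\ a) :|: B) ->
  lister_guarantees G k (A :|: (B :\ b)) ->
  lister_guarantees G k.+2 (A :|: B).
Proof.
move=> AB aA bB LA LB.
rewrite -[k.+2]/(1 + 1 + k) -{1}(cards1 a) -(cards1 b).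
apply: lister_guarantees_join; rewrite ?sub1set //.
by apply/set0Pn; exists a; rewrite inE.
Qed.

Lemma join_sub G A B A' B' :
  A' \subset A -> B' \subset B -> {in A & B, forall x y, adj G x y} ->
  {in A' & B', forall x y, adj G x y}.
Proof. by move=> /subsetP sA /subsetP sB h x y /sA xA /sB; apply: h. Qed.

Lemma join_sym G A B :
  {in A & B, forall x y, adj G x y} -> {in B & A, forall x y, adj G x y}.
Proof. by move=> h x y xB yA; rewrite adj_sym h. Qed.

Lemma lister_guarantees_all G U : lister_guarantees G #|U| U.
Proof.
have [->|U0] := eqVneq U set0; first by rewrite cards0.
by rewrite -[#|U|]addn0; apply: lister_guarantees_mark; rewrite /lister_move ?U0 ?subxx.
Qed.

(** Marking one vertex on each side earns 2, while the bound drops by 1 or 2: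
    by 2 if the smaller side loses a vertex, by 1 if a strictly larger side
    does.  For sides of equal size it drops by 2 in either case, because a side
    that loses a vertex then becomes the smaller one. *)
Lemma lister_guarantees_join_le G A B :
  {in A & B, forall x y, adj G x y} -> #|B| <= #|A| ->
  lister_guarantees G (#|A| + 2 * #|B|) (A :|: B).
Proof.
have [n] := ubnP (#|A| + #|B|); elim: n A B => // n IH A B ABn AB BA.
have [->|/set0Pn[b bB]] := eqVneq B set0.
  by rewrite cards0 muln0 addn0 setU0 lister_guarantees_all.
have /card_gt0P[a aA] : 0 < #|A|.
  by apply: leq_trans BA; apply/card_gt0P; exists b.
have cA := cardsD1 a A; have cB := cardsD1 b B; rewrite aA bB in cA cB.
have -> : #|A| + 2 * #|B| = (#|A| + 2 * #|B :\ b|).+2 by lia.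
apply: (lister_guarantees_join1 AB aA bB); last first.
  by apply: IH; [lia | apply: join_sub AB; rewrite ?subD1set | lia].
have [BA'|AB'] := leqP #|B| #|A :\ a|.
  apply: (@lister_guarantees_le _ _ _ (#|A :\ a| + 2 * #|B|)); first by lia.
  by apply: IH; [lia | apply: join_sub AB; rewrite ?subD1set | lia].
apply: (@lister_guarantees_le _ _ _ (#|B| + 2 * #|A :\ a|)); first by lia.
rewrite setUC; apply: IH; [lia | | lia].
by apply: join_sym; apply: join_sub AB; rewrite ?subD1set.
Qed.

(** Marking one vertex on each side gives the extra point as soon as Painter
    colors in a strictly larger A, as the bound then drops only by 1; otherwise
    the smaller side shrinks and induction applies.  A single vertex b in B
    needs a different move, since Painter would color b and leave only
    2 + #|A| in total: Lister marks b and two vertices of A. *)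
Lemma lister_guarantees_join_lt G A B :
  {in A & B, forall x y, adj G x y} -> 0 < #|B| <= #|A| -> 2 < #|A| ->
  lister_guarantees G (#|A| + 2 * #|B|).+1 (A :|: B).
Proof.
have [n] := ubnP #|B|; elim: n A B => // n IH A B Bn AB /andP[B0 BA] A2.
have /card_gt0P[b bB] := B0.
have /card_gt0P[a aA] : 0 < #|A| by lia.
have cA := cardsD1 a A; have cB := cardsD1 b B; rewrite aA bB in cA cB.
have [B1|B1] := leqP #|B| 1.
  have /card_gt0P[a' a'A] : 0 < #|A :\ a| by lia.
  have cA' := cardsD1 a' (A :\ a); rewrite a'A in cA'.
  have aa' : a != a' by move: a'A; rewrite !inE eq_sym => /andP[].
  have -> : (#|A| + 2 * #|B|).+1 = #|[set a; a']| + #|[set b]| + #|A|.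
    by rewrite cards2 aa' cards1; lia.
  apply: lister_guarantees_join => //.
  - by rewrite subUset !sub1set aA; move: a'A; rewrite inE => /andP[].
  - by rewrite sub1set.
  - by apply/set0Pn; exists a; rewrite !inE eqxx.
  - rewrite -setDDl (_ : #|A| = #|A :\ a :\ a'| + 2 * #|B|); last by lia.
    apply: lister_guarantees_join_le; last by lia.
    apply: join_sub AB => //; exact: subset_trans (subD1set _ _) (subD1set _ _).
  - by apply: lister_guarantees_sub (subsetUl _ _) _; apply: lister_guarantees_all.
have -> : (#|A| + 2 * #|B|).+1 = (#|A| + 2 * #|B :\ b|).+3 by lia.
apply: (lister_guarantees_join1 AB aA bB); last first.
  by apply: IH; [lia | apply: join_sub AB; rewrite ?subD1set | lia | lia].
have [BA'|AB'] := leqP #|B| #|A :\ a|.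
  apply: (@lister_guarantees_le _ _ _ (#|A :\ a| + 2 * #|B|)); first by lia.
  by apply: lister_guarantees_join_le; [apply: join_sub AB; rewrite ?subD1set | lia].
apply: (@lister_guarantees_le _ _ _ (#|B| + 2 * #|A :\ a|).+1); first by lia.
rewrite setUC; apply: IH; [lia | | lia | lia].
by apply: join_sym; apply: join_sub AB; rewrite ?subD1set.
Qed.

(** * Complete multipartite graphs *)

Definition nonneighbors G x : {set T} := [set y in vertices G | ~~ adj G x y].

Lemma nonneighbors_self G x : x \in vertices G -> x \in nonneighbors G x.
Proof. by rewrite inE adj_irr andbT. Qed.

Lemma independent_nonneighbors G I x :
  independent G I -> x \in I -> I \subset nonneighbors G x.
Proof.
case/independentP=> /subsetP IV iI xI; apply/subsetP => y yI.
by rewrite inE IV // iI.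
Qed.

(** As adjacency is symmetric and irreflexive, this makes nonadjacency an
    equivalence relation on the vertices.  Its classes [nonneighbors G x] are
    the parts of a complete multipartite graph. *)
Definition nonadj_trans G :=
  {in vertices G & &, forall y x z, ~~ adj G x y -> ~~ adj G y z -> ~~ adj G x z}.

Lemma complete_multipartite_nonadj_trans G :
  complete_multipartite G -> nonadj_trans G.
Proof.
case=> P _ h y x z yV xV zV; rewrite !h // !negbK => /eqP-> /eqP->.
by rewrite eqxx.
Qed.

Lemma nonneighbors_independent G x :
  nonadj_trans G -> x \in vertices G -> independent G (nonneighbors G x).
Proof.
move=> tG xV; apply/independentP; split.
  by apply/subsetP => y; rewrite inE => /andP[].
move=> y z; rewrite !inE => /andP[yV xy] /andP[zV xz].
by apply: (tG x) => //; rewrite adj_sym.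
Qed.

Lemma card_nonneighbors_degree G x :
  #|nonneighbors G x| + degree G x = #|vertices G|.
Proof.
rewrite /degree -(cardsID [set y | adj G x y] (vertices G)) addnC.
congr (_ + _); last by apply: eq_card => y; rewrite !inE andbC.
apply: eq_card => y; rewrite !inE andb_idl //.
by case/adj_vertices/andP.
Qed.

(** A class is independent, and an independent set lies in a class; regularity
    makes all classes equally large. *)
Lemma card_nonneighbors G x :
  nonadj_trans G -> regular G -> x \in vertices G ->
  #|nonneighbors G x| = alpha G.
Proof.
move=> tG [d dG] xV; apply/eqP; rewrite eqn_leq.
rewrite card_independent ?nonneighbors_independent //=.
have [A iA <-] := alpha_witness G.
have [->|/set0Pn[y yA]] := eqVneq A set0; first by rewrite cards0.
have /independentP[/subsetP/(_ y yA) yV _] := iA.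
apply: leq_trans (subset_leq_card (independent_nonneighbors iA yA)) _.
have := card_nonneighbors_degree G x; have := card_nonneighbors_degree G y.
by rewrite !dG //; lia.
Qed.

(** The set U is a union of parts.  While more than two parts remain, Lister
    marks everything: if Painter colors a whole part, U stays a union of parts,
    and otherwise the general lower bound becomes strict in this round. *)
Lemma painter_guarantees_multipartite G k U :
  nonadj_trans G -> {in vertices G, forall x, #|nonneighbors G x| = alpha G} ->
  2 < alpha G -> alpha G < #|U| -> U \subset vertices G ->
  {in U, forall x, nonneighbors G x \subset U} ->
  painter_guarantees G k U ->
  #|U| ^ 2 + alpha G * #|U| < 2 * alpha G * k.
Proof.
move=> tG cG a2; elim/ltn_ind: k U => k IH U aU UV clU PU.
have /card_gt0P[x xU] : 0 < #|U| by lia.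
have xV := subsetP UV x xU.
have sx := clU x xU; have cx := cG x xV.
have cUx := card_setD_sub sx; rewrite cx in cUx.
have [U2|U2] := leqP #|U| (2 * alpha G).
  (* With alpha < u <= 2 alpha, Lister gets 2u - alpha + 1 on the join of a part
     and the rest, and (u - alpha) (u - 2 alpha) <= 0 < 2 alpha. *)
  have : lister_guarantees G (#|nonneighbors G x| + 2 * #|U :\: nonneighbors G x|).+1 U.
    have eU := setID U (nonneighbors G x); rewrite (setIidPr sx) in eU.
    rewrite -[X in lister_guarantees _ _ X]eU.
    apply: lister_guarantees_join_lt; rewrite ?cx; try lia.
    move=> y z; rewrite !inE => /andP[yV xy] /andP[xz zU].
    have zV := subsetP UV z zU; rewrite zV /= negbK in xz.
    by apply: contraTT xz => yz; apply: (tG y).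
  rewrite cx => LU; have kl : alpha G + 2 * #|U :\: nonneighbors G x| < k.
    rewrite ltnNge; apply: contraL PU => kl; rewrite painter_lister negbK.
    exact: lister_guarantees_le LU.
  nia.
have [|I [/andP[IU iI] Uk PI]] := painter_guarantees_colorI (M := U) PU.
  by rewrite /lister_move subxx andbT -card_gt0; lia.
have cI := card_setD_sub IU; have := card_independent iI.
have ek : k = #|U| + (k - #|U|) by lia.
rewrite leq_eqVlt => /orP[/eqP Ia|Ia]; last first.
  have := painter_guarantees_lower PI.
  rewrite [in X in _ -> X]ek; move: (k - #|U|) => l.
  by move: #|U :\: I| #|I| #|U| (alpha G) cI Ia aU {IH U2 ek PI cUx cx a2 cG Uk} => *; nia.
have clI : {in U :\: I, forall z, nonneighbors G z \subset U :\: I}.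
  move=> z /setDP[zU zI]; rewrite subsetD clU //=.
  apply/pred0P => y /=; apply/negbTE/negP => /andP[yz yI].
  have yV : y \in vertices G by apply/(subsetP UV)/(subsetP IU).
  have yI' : nonneighbors G y = I.
    by apply/esym/eqP; rewrite eqEcard independent_nonneighbors // cG // Ia /=.
  move: zI; rewrite -yI' inE (subsetP UV) //= adj_sym.
  by move: yz; rewrite inE => /andP[_ ->].
have := IH _ _ (U :\: I) _ (subset_trans (subsetDl _ _) UV) clI PI.
move=> /(_ ltac:(lia) ltac:(lia)); rewrite [in X in _ -> X]ek.
move: (k - #|U|) => l.
by move: #|U :\: I| #|I| #|U| (alpha G) cI Ia aU {IH U2 ek PI cUx cx a2 cG Uk} => *; nia.
Qed.

(** * Independence number at most two *)

(** When nonadjacency is an equivalence, these are the vertices of U whose part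
    contains no other vertex of U. *)
Definition dominating G U : {set T} :=
  [set x in U | [forall y in U, (y != x) ==> adj G x y]].

Lemma dominatingPn G U x :
  x \in U -> x \notin dominating G U ->
  exists2 y, y \in U & (y != x) && ~~ adj G x y.
Proof.
rewrite inE => -> /forall_inPn[y yU]; rewrite negb_imply => h.
by exists y.
Qed.

Lemma dominating_adj G U x y :
  x \in dominating G U -> y \in U -> y != x -> adj G x y.
Proof. by rewrite inE => /andP[_ /forall_inP h] /h/implyP. Qed.

Lemma dominating_setD G U I x :
  x \in dominating G (U :\: I) -> x \notin dominating G U ->
  exists2 y, y \in I & (y != x) && ~~ adj G x y.
Proof.
move=> xI xU; have : x \in U :\: I by move: xI; rewrite inE => /andP[].
case/setDP=> xU' _; have [y yU /andP[yx xy]] := dominatingPn xU' xU.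
exists y; last by rewrite yx.
apply: contraR xy => yI; apply: dominating_adj xI _ yx.
by rewrite inE yI.
Qed.

(** Sending a nondominating vertex of the clique M to a nonneighbor of it in U
    is injective, since two vertices with a common nonneighbor are nonadjacent;
    the images are neither in M nor dominating. *)
Lemma card_clique_nondominating G U M :
  nonadj_trans G -> U \subset vertices G -> M \subset U ->
  {in M &, forall x y, y != x -> adj G x y} ->
  2 * #|M :\: dominating G U| + #|dominating G U| <= #|U|.
Proof.
move=> tG UV MU cM; set D := dominating G U; set N := M :\: D.
pose f x := odflt x [pick y in U | (y != x) && ~~ adj G x y].
have fP x : x \in N -> [/\ f x \in U, f x != x & ~~ adj G x (f x)].
  case/setDP=> xM xD; rewrite /f; case: pickP => [y /and3P[] //|].
  have [y yU h] := dominatingPn (subsetP MU x xM) xD.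
  by move/(_ y); rewrite yU h.
have NU x : x \in N -> x \in U by case/setDP=> /(subsetP MU).
have fI : {in N &, injective f}.
  move=> x y xN yN exy; have [fU _ fx] := fP x xN; have [_ _ fy] := fP y yN.
  apply/eqP; apply: contraT => xy; rewrite eq_sym in xy.
  have /setDP[xM _] := xN; have /setDP[yM _] := yN.
  have : ~~ adj G x y.
    apply: (tG (f x)); rewrite ?(subsetP UV) ?fU ?(NU _ xN) ?(NU _ yN) //.
    by rewrite adj_sym exy.
  by rewrite cM.
have dNf : [disjoint N & f @: N].
  apply/pred0P => y /=; apply/negbTE/negP => /andP[yN /imsetP[x xN ey]].
  have [_ fx nx] := fP x xN; have /setDP[xM _] := xN; have /setDP[yM _] := yN.
  by rewrite -ey cM // ey in nx.
have dD : [disjoint N :|: f @: N & D].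
  apply/pred0P => y /=; apply/negbTE/negP => /andP[/setUP[/setDP[_ /negP//]|]].
  case/imsetP=> x xN -> fD; have [_ fx nx] := fP x xN.
  by rewrite adj_sym (dominating_adj fD) ?NU // eq_sym in nx.
have cU : #|N :|: f @: N :|: D| = 2 * #|N| + #|D|.
  rewrite cardsU disjoint_setI0 // cards0 subn0.
  by rewrite cardsU disjoint_setI0 // cards0 subn0 card_in_imset // mul2n addnn.
rewrite -cU subset_leq_card // !subUset; apply/andP; split; last first.
  by apply/subsetP => x; rewrite inE => /andP[].
apply/andP; split; first by apply/subsetP => x /NU.
by apply/subsetP => _ /imsetP[x /fP[fU _ _] ->].
Qed.

(** Painter colors two nonadjacent marked vertices if possible; the potential
    then drops by at least 4 #|U| >= 4 #|M|.  Otherwise M is a clique.  Let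
    u = #|U| and d be the number of dominating vertices.  If M contains a
    dominating vertex, coloring it lowers the potential by at least 2u + 2d, and
    2 #|M| <= u + d.  If not, coloring any marked vertex creates at most one
    dominating vertex, so the potential drops by at least 2u - 2d, and
    2 #|M| <= u - d. *)
Lemma lister_guarantees_alpha2 G k U :
  nonadj_trans G -> alpha G <= 2 -> U \subset vertices G ->
  lister_guarantees G k U ->
  4 * k <= #|U| * (#|U| + 2) + #|dominating G U| ^ 2.
Proof.
move=> tG a2; elim/ltn_ind: k U => k IH U UV LU.
have [->//|k0] := posnP k.
have [M /andP[M0 MU] LM] := lister_guarantees_markI k0 LU.
rewrite -card_gt0 in M0.
suff [I MI h] : exists2 I, painter_move G M I &
    #|U :\: I| * (#|U :\: I| + 2) + #|dominating G (U :\: I)| ^ 2 + 4 * #|M|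
    <= #|U| * (#|U| + 2) + #|dominating G U| ^ 2.
  have := IH _ _ _ (subset_trans (subsetDl _ _) UV) (LM I MI).
  by move=> /(_ ltac:(lia)); lia.
have MV := subset_trans MU UV; have cMU := subset_leq_card MU.
have nn2 x : x \in vertices G -> #|nonneighbors G x| <= 2.
  by move=> xV; apply: leq_trans a2; apply/card_independent/nonneighbors_independent.
have [/existsP[[x y] /and4P[/= xM yM xy nxy]]|cM] :=
  boolP [exists p, [&& p.1 \in M, p.2 \in M, p.2 != p.1 & ~~ adj G p.1 p.2]].
  have xV := subsetP MV x xM; have yV := subsetP MV y yM.
  have nx : nonneighbors G x = [set x; y].
    apply/esym/eqP; rewrite eqEcard cards2 eq_sym xy nn2 // andbT.
    by rewrite subUset !sub1set nonneighbors_self // inE yV.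
  exists [set x; y].
    rewrite /painter_move -{2}nx nonneighbors_independent // andbT.
    by rewrite subUset !sub1set xM.
  have cI : #|U :\: [set x; y]| + 2 = #|U|.
    rewrite -(@card_setD_sub U [set x; y]) ?cards2 1?eq_sym ?xy //.
    by rewrite subUset !sub1set !(subsetP MU).
  have cD : #|dominating G (U :\: [set x; y])| <= #|dominating G U|.
    apply/subset_leq_card/subsetP => z zI; apply: contraT => zU.
    have [w wI /andP[wz nzw]] := dominating_setD zI zU.
    have zI' : z \in U :\: [set x; y] by move: zI; rewrite inE => /andP[].
    have /setDP[zU' /negP[]] := zI'; have zV := subsetP UV z zU'.
    rewrite -nx inE zV /=.
    rewrite -nx inE in wI; have /andP[wV xw] := wI.
    by apply: (tG w) => //; rewrite adj_sym.
  nia.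
have {}cM : {in M &, forall x y, y != x -> adj G x y}.
  move=> x y xM yM yx; apply: contraR cM => nxy.
  by apply/existsP; exists (x, y); rewrite /= xM yM yx.
have cN := card_clique_nondominating tG UV MU cM.
have color1 x : x \in M -> painter_move G M [set x].
  by move=> xM; rewrite /painter_move sub1set xM independent1 ?(subsetP MV).
have card1 x : x \in M -> #|U :\: [set x]| + 1 = #|U|.
  by move=> xM; rewrite -(@card_setD_sub U [set x]) ?cards1 // sub1set (subsetP MU).
have [MD|/set0Pn[x /setIP[xM xD]]] := eqVneq (M :&: dominating G U) set0.
  have /card_gt0P[x xM] := M0; exists [set x]; first exact: color1.
  have cI := card1 x xM; have xV := subsetP MV x xM.
  have cD : #|dominating G (U :\: [set x])| <= #|dominating G U| + 1.
    have sD : dominating G (U :\: [set x]) \subset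
              dominating G U :|: nonneighbors G x :\ x.
      apply/subsetP => z zI; have [zU|zU] := boolP (z \in dominating G U).
        by rewrite inE zU.
      have [_ /set1P-> /andP[xz nzx]] := dominating_setD zI zU.
      rewrite !inE; apply/orP; right; rewrite eq_sym xz adj_sym nzx andbT.
      by move: zI; rewrite !inE => /andP[/andP[_ /(subsetP UV)]].
    apply: leq_trans (subset_leq_card sD) _; rewrite cardsU.
    have := nn2 x xV; rewrite (cardsD1 x (nonneighbors G x)) nonneighbors_self //.
    by lia.
  have MD' : #|M :\: dominating G U| = #|M| by rewrite cardsD MD cards0 subn0.
  nia.
exists [set x]; first exact: color1.
have cI := card1 x xM.
have cD : #|dominating G (U :\: [set x])| + 1 <= #|dominating G U|.
  rewrite (cardsD1 x (dominating G U)) xD addnC leq_add2l.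
  apply/subset_leq_card/subsetP => z zI.
  have : z \in U :\: [set x] by move: zI; rewrite inE => /andP[].
  case/setDP=> zU zx; rewrite in_setD zx /=; apply: contraT => zD.
  have [_ /set1P-> /andP[xz]] := dominating_setD zI zD.
  by rewrite adj_sym (dominating_adj xD) // eq_sym.
have cMD := cardsID (dominating G U) M.
have cMI := subset_leq_card (subsetIr M (dominating G U)).
nia.
Qed.

(** * The bounds *)

Local Open Scope ring_scope.

Lemma card_vertices_gt0 G : vertices G != set0 -> 0 < #|vertices G|%:R :> rat.
Proof. by move=> V0; rewrite ltr0n card_gt0. Qed.

(** Both sides become fractions with denominator 2 alpha n. *)
Lemma lower_bound_average G : vertices G != set0 ->
  ((lower_bound G <= average_cost G) =
     (#|vertices G| ^ 2 + alpha G * #|vertices G| <= 2 * alpha G * sum_color_cost G)%N)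
  * ((lower_bound G == average_cost G) =
     (#|vertices G| ^ 2 + alpha G * #|vertices G| == 2 * alpha G * sum_color_cost G)%N).
Proof.
move=> V0; have n0 := card_vertices_gt0 V0.
have a0 : 0 < (alpha G)%:R :> rat by rewrite ltr0n alpha_gt0.
rewrite /lower_bound /average_cost.
move: #|vertices G| (alpha G) (sum_color_cost G) n0 a0 => n a s n0 a0.
have e : n%:R / (2%:R * a%:R) + 1 / 2%:R =
  (n ^ 2 + a * n)%N%:R / (2 * a * n)%N%:R :> rat.
  rewrite natrD natrX !natrM; field; lra.
have e' : s%:R / n%:R = (2 * a * s)%N%:R / (2 * a * n)%N%:R :> rat.
  by rewrite !natrM; field; lra.
have d0 : 0 < (2 * a * n)%N%:R :> rat by rewrite !natrM; nra.
rewrite e e'; split; first by rewrite ler_pM2r ?invr_gt0 // ler_nat.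
by rewrite (inj_eq (mulIf _)) ?invr_eq0 ?lt0r_neq0 // eqr_nat.
Qed.

Lemma upper_bound_ge G H : subgraph H G -> vertices H != set0 ->
  #|vertices H|%:R / (alpha H)%:R <= upper_bound G.
Proof.
by move=> HG H0; rewrite /upper_bound; apply: le_bigmax_cond; rewrite HG.
Qed.

Lemma upper_bound_ge1 G : vertices G != set0 -> 1 <= upper_bound G.
Proof.
move=> V0; have GG : subgraph G G by rewrite /subgraph !subxx.
apply: le_trans (upper_bound_ge GG V0).
rewrite ler_pdivlMr ?ltr0n ?alpha_gt0 // mul1r ler_nat.
exact: alpha_le_card.
Qed.

Lemma upper_bound_gt1 G : edges G != set0 -> vertices G != set0 ->
  1 < upper_bound G.
Proof.
move=> E0 V0; have GG : subgraph G G by rewrite /subgraph !subxx.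
apply: lt_le_trans (upper_bound_ge GG V0).
rewrite ltr_pdivlMr ?ltr0n ?alpha_gt0 // mul1r ltr_nat.
rewrite ltn_neqAle alpha_edgeless E0 /=.
exact: alpha_le_card.
Qed.

Lemma upper_bound_edgeless G : vertices G != set0 -> edges G = set0 ->
  upper_bound G = 1.
Proof.
move=> V0 E0; apply/le_anti; rewrite upper_bound_ge1 // andbT.
apply: bigmax_le => // H /andP[HG H0].
have := edgeless_subgraph E0 HG => /eqP; rewrite -alpha_edgeless => /eqP->.
by rewrite divff // lt0r_neq0 // card_vertices_gt0.
Qed.

Lemma sum_color_cost_upper G : vertices G != set0 ->
  (sum_color_cost G)%:R <= upper_bound G * #|vertices G|%:R - (upper_bound G - 1).
Proof.
move=> V0; apply: lister_guarantees_upper (lister_guarantees_cost G) => //.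
  exact: upper_bound_ge1.
move=> M M0 MV; have vM : vertices (induced G M) = M by apply/setIidPr.
have [I iI cI] := alpha_witness (induced G M).
exists I; first exact: independent_induced.
have := upper_bound_ge (induced_subgraph G M); rewrite vM -cI => /(_ M0).
by rewrite ler_pdivrMr // ltr0n cI alpha_gt0 ?vM.
Qed.

Lemma lower_bound_edgeless G : vertices G != set0 -> edges G = set0 ->
  lower_bound G = 1.
Proof.
move=> V0 /eqP; rewrite -alpha_edgeless /lower_bound => /eqP->.
by have := card_vertices_gt0 V0 => n0; field; lra.
Qed.

Lemma lower_boundP G : vertices G != set0 -> lower_bound G <= average_cost G.
Proof.
move=> V0; rewrite lower_bound_average //.
exact/painter_guarantees_lower/painter_guarantees_cost.
Qed.

Lemma average_cost_upper G : vertices G != set0 ->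
  average_cost G <= upper_bound G - (upper_bound G - 1) / #|vertices G|%:R.
Proof.
move=> V0; have n0 := card_vertices_gt0 V0.
rewrite /average_cost ler_pdivrMr // mulrBl mulfVK ?lt0r_neq0 //.
exact: sum_color_cost_upper.
Qed.

Lemma upper_boundP G : vertices G != set0 -> average_cost G <= upper_bound G.
Proof.
move=> V0; apply: le_trans (average_cost_upper V0) _.
rewrite gerBl divr_ge0 ?ler0n // subr_ge0; exact: upper_bound_ge1.
Qed.

Lemma edgeless_bounds G : vertices G != set0 -> edges G = set0 ->
  lower_bound G = average_cost G /\ average_cost G = upper_bound G.
Proof.
move=> V0 E0; have a1 : average_cost G = 1.
  apply/le_anti; rewrite -{1}(upper_bound_edgeless V0 E0) upper_boundP //.
  by rewrite -(lower_bound_edgeless V0 E0) lower_boundP.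
by rewrite a1 upper_bound_edgeless // lower_bound_edgeless.
Qed.

Lemma upper_bound_eq G : vertices G != set0 ->
  average_cost G = upper_bound G <-> edges G = set0.
Proof.
move=> V0; split=> [e|E0]; last by have [] := edgeless_bounds V0 E0.
apply/eqP; apply: contraT => E0; have := average_cost_upper V0.
rewrite e lerBrDr gerDl leNgt divr_gt0 ?card_vertices_gt0 //.
by rewrite subr_gt0 upper_bound_gt1.
Qed.

Lemma chromatic_number1 G : vertices G != set0 ->
  chromatic_number G = 1%N <-> edges G = set0.
Proof.
move=> V0; rewrite /chromatic_number; case: ex_minnP => k ck min_k.
have k0 : (0 < k)%N.
  case/set0Pn: V0 => x xV; case/existsP: ck => f _.
  by case: k f {min_k} => // f; case: (f (exist _ x xV)).
split=> [k1|E0].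
  apply/eqP; rewrite -alpha_edgeless eqn_leq; apply/andP; split.
    exact: alpha_le_card.
  apply/card_independent/independentP; split=> // x y xV yV.
  subst k; case/existsP: ck => f.
  move=> /forallP/(_ (exist _ x xV))/forallP/(_ (exist _ y yV))/implyP.
  by case: adj => // /(_ isT); rewrite !ord1 eqxx.
apply/eqP; rewrite eqn_leq k0 andbT; apply: min_k.
apply/existsP; exists [ffun=> ord0]; apply/forallP => x; apply/forallP => y.
by rewrite /adj E0 inE.
Qed.

Lemma lower_bound_eq G : vertices G != set0 ->
  complete_multipartite G -> regular G ->
  lower_bound G = average_cost G <->
    chromatic_number G = 1%N \/ (alpha G <= 2)%N.
Proof.
move=> V0 /complete_multipartite_nonadj_trans tG rG.
have cG := card_nonneighbors tG rG.
rewrite chromatic_number1 //; split=> [/eqP|[E0|a2]].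
- rewrite lower_bound_average // => e.
  have [E0|E0] := eqVneq (edges G) set0; [by left | right].
  rewrite leqNgt; apply/negP => a3; move: e; apply/negP.
  rewrite neq_ltn; apply/orP; left.
  apply: painter_guarantees_multipartite (painter_guarantees_cost G) => //.
  + rewrite ltn_neqAle alpha_edgeless E0 /=.
    exact: alpha_le_card.
  + by move=> x _; apply/subsetP => y; rewrite inE => /andP[].
- by have [] := edgeless_bounds V0 E0.
apply/eqP; rewrite lower_bound_average //.
rewrite eqn_leq (painter_guarantees_lower (painter_guarantees_cost G)) /=.
have := lister_guarantees_alpha2 tG a2 (subxx _) (lister_guarantees_cost G).
have Dn : (#|dominating G (vertices G)| <= #|vertices G|)%N.
  by apply/subset_leq_card/subsetP => x; rewrite inE => /andP[].
(* Every vertex is dominating if alpha = 1, none if alpha = 2; in both cases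
   the potential is 4 (n^2 / (2 alpha) + n / 2). *)
have [a1|a1] := leqP (alpha G) 1.
  by have -> : alpha G = 1%N by [have := alpha_gt0 V0; lia]; nia.
have ea : alpha G = 2 by lia.
rewrite (_ : dominating G (vertices G) = set0) ?cards0 ?ea; first by lia.
apply/eqP; rewrite -subset0; apply/subsetP => x xD; exfalso.
have xV : x \in vertices G by move: xD; rewrite inE => /andP[].
have : (#|nonneighbors G x| <= 1)%N.
  rewrite -(cards1 x); apply/subset_leq_card/subsetP => y.
  rewrite !inE => /andP[yV]; apply: contraR.
  exact: (dominating_adj xD yV).
by rewrite cG // ea.
Qed.

Lemma edgeless_graph_simple (n : nat) : @simple_graph 'I_n (setT, set0).
Proof. by apply/forall_inP => e; rewrite inE. Qed.

End Graph.

Local Open Scope ring_scope.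

Theorem theorem1p5 :
  (forall (T : finType) (G : graph T), vertices G != set0 ->
     [/\ lower_bound G <= average_cost G,
         average_cost G <= upper_bound G,
         average_cost G = upper_bound G <-> edges G = set0 &
         complete_multipartite G -> regular G ->
           (lower_bound G = average_cost G <->
              chromatic_number G = 1%N \/ (alpha G <= 2)%N)])
  /\ (forall n : nat, (0 < n)%N ->
        (exists (T : finType) (G : graph T),
           #|vertices G| = n /\ lower_bound G = average_cost G)
        /\ (exists (T : finType) (G : graph T),
           #|vertices G| = n /\ average_cost G = upper_bound G)).
Proof.
split=> [T G V0|n n0].
  split; [exact: lower_boundP | exact: upper_boundP | exact: upper_bound_eq |].
  exact: lower_bound_eq.
have cn : #|vertices (Graph (edgeless_graph_simple n))| = n.
  by rewrite cardsT card_ord.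
have V0 : vertices (Graph (edgeless_graph_simple n)) != set0.
  by rewrite -card_gt0 cn.
have [lo up] := edgeless_bounds V0 (erefl _).
by split; exists 'I_n, (Graph (edgeless_graph_simple n)).
Qed.
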